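(* Let $\sigma,\tau>0$ with $\sigma\neq\tau$, let $\beta\in[0,1)$ and $\gamma>0$. Under $\mathbb P_0$ let $X_1,X_2,\dots$ be i.i.d. normal with mean $0$ and variance $\sigma^2$. Let $f_n$ be the density of $\mathscr N(\boldsymbol0,\sigma^2I_n)$ and $g_{n,\beta}$ the density of $\mathscr N(\boldsymbol 0,T_n)$, where $T_n$ is the $n\times n$ diagonal matrix with $\sigma^2$ at the first $\lfloor\beta n\rfloor$ diagonal positions and $\tau^2$ at the other diagonal positions. Suppose the real number $b(\beta)$ satisfies $$b(\beta)>\lim_{n\to\infty}\frac1n\mathbb E_0\log\frac{g_{n,\beta}(X_1,\dots,X_n)}{f_n(X_1,\dots,X_n)},\qquad \frac{-2\tau^2}{\sigma^2-\tau^2}\left(\frac{b(\beta)}{1-\beta}-\log\frac\sigma\tau\right)>0,$$ and $$\gamma=(1-\beta)\left(-\frac12-\frac{\tau^2}{\sigma^2-\tau^2}\left(\frac{b(\beta)}{1-\beta}-\log\frac\sigma\tau\right)-\frac12\log\left(\frac{-2\tau^2}{\sigma^2-\tau^2}\left(\frac{b(\beta)}{1-\beta}-\log\frac\sigma\tau\right)\right)\right).$$ Then $$\lim_{n\to\infty}\frac1n\log\mathbb P_0\left(\frac1n\log\frac{g_{n,\beta}(X_1,\dots,X_n)}{f_n(X_1,\dots,X_n)}\ge b(\beta)\right)=-\gamma .$$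
   Context: $\mathscr N(\boldsymbol\mu,\Sigma)$ denotes the multivariate normal distribution with mean $\boldsymbol\mu$ and covariance matrix $\Sigma$; $I_n$ is the $n\times n$ identity matrix; $\mathbb E_0$ is expectation under $\mathbb P_0$. The number $b(\beta)$ serves as the alarm threshold of a log-likelihood-ratio test for a change of variance from $\sigma^2$ to $\tau^2$ at observation $\lfloor\beta n\rfloor+1$. *)

(* Defs.v *)
From HB Require Import structures.
From mathcomp Require Import all_boot all_order all_algebra.
From mathcomp Require Import all_classical all_reals all_analysis.

Set Implicit Arguments.
Unset Strict Implicit.
Unset Printing Implicit Defensive.

Import Order.TTheory GRing.Theory Num.Theory.
Import numFieldNormedType.Exports.

Local Open Scope classical_set_scope.
Local Open Scope ring_scope.

(* Mutual independence: the product rule over every finite subfamily. *)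
Definition mutually_independent (d : measure_display) (T : measurableType d)
    (R : realType) (P : probability T R) (I : eqType)
    (X : I -> {RV P >-> R}) : Prop :=
  forall (s : seq I) (B : I -> set R),
    uniq s -> (forall i, i \in s -> measurable (B i)) ->
    P (\bigcap_(i in [set` s]) (X i @^-1` B i)) =
      (\prod_(i <- s) P (X i @^-1` B i))%E.

(* The second parameter of [normal_prob] is the standard deviation. *)
Definition iid_centered_normal (d : measure_display) (T : measurableType d)
    (R : realType) (P : probability T R) (I : eqType)
    (X : I -> {RV P >-> R}) (sigma : R) : Prop :=
  mutually_independent X /\
  forall i (B : set R), measurable B ->
    distribution P (X i) B = normal_prob 0 sigma B.

(* Density at x of the normal distribution with mean mu and positive definite
   covariance matrix S:
   ((2 pi)^n det S)^(-1/2) exp (- (x - mu) S^-1 (x - mu)^T / 2). *)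
Definition mvnormal_pdf (R : realType) (n : nat) (mu : 'rV[R]_n)
    (S : 'M[R]_n) (x : 'rV[R]_n) : R :=
  (Num.sqrt ((2 * pi) ^+ n * \det S))^-1 *
  expR (- (((x - mu) *m invmx S *m (x - mu)^T) 0 0 / 2)).

(* The 1-based positions 1, ..., floor (beta n) are the ordinals
   i < floor (beta n). *)
Definition change_cov (R : realType) (sigma tau beta : R) (n : nat) :
    'M[R]_n :=
  diag_mx (\row_(i < n)
    if (i < Num.truncn (beta * n%:R))%N then sigma ^+ 2 else tau ^+ 2).

Definition null_pdf (R : realType) (sigma : R) (n : nat) : 'rV[R]_n -> R :=
  mvnormal_pdf 0 (sigma ^+ 2)%:M.

Definition change_pdf (R : realType) (sigma tau beta : R) (n : nat) :
    'rV[R]_n -> R :=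
  mvnormal_pdf 0 (change_cov sigma tau beta n).

(* The sample (X_1, ..., X_n) is (X 0, ..., X n.-1). *)
Definition sample (T : Type) (R : realType) (X : nat -> T -> R) (n : nat)
    (w : T) : 'rV[R]_n :=
  \row_(i < n) X i w.

Definition log_lr (T : Type) (R : realType) (X : nat -> T -> R)
    (sigma tau beta : R) (n : nat) (w : T) : R :=
  ln (change_pdf sigma tau beta (sample X n w) /
      null_pdf sigma (sample X n w)).

(* Main.v *)
Require Import Defs.
From HB Require Import structures.
From mathcomp Require Import all_boot all_order all_algebra.
From mathcomp Require Import all_classical all_reals all_analysis.
From mathcomp Require Import measurable_realfun ring lra.

Set Implicit Arguments.
Unset Strict Implicit.
Unset Printing Implicit Defensive.

Import Order.TTheory GRing.Theory Num.Theory.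
Import numFieldNormedType.Exports.

Local Open Scope classical_set_scope.
Local Open Scope ring_scope.

(** Only the observations after the change point matter: the log-likelihood
ratio of the first n observations is the sum, over the n - floor (beta n)
indices i past the change, of L + c X_i^2, where L = ln (sigma / tau) and
c = (1 / sigma^2 - 1 / tau^2) / 2 ([log_lr_sum]). By independence and the
Gaussian integral its moment generating function is explicit
([mgf_log_lr]), and with a = c sigma^2 its scaled logarithm converges to
   Gamma(s) = (1 - beta) (s L - ln (1 - 2 s a) / 2).
With t the quantity whose logarithm occurs in gamma, the threshold is
b = (1 - beta) (L + a t) = Gamma'(s0), where 1 - 2 s0 a = 1 / t, and the
exponent is Gamma(s0) - s0 b = - gamma. The limiting mean is
(1 - beta) (L + a), so the hypothesis that b exceeds it says a (t - 1) > 0,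
that is, s0 > 0: b is reached by an upper tail. The result is then a
Gaertner-Ellis theorem on a half line ([gartner_ellis_half_line]).

The upper bound in that theorem is the exponential Markov inequality. The
lower bound usually goes through a change of measure and a law of large
numbers for the tilted law. Here the tilting is carried out inside moment
generating functions only, through the pointwise inequality [expR_tilt_le]:
the mass that exp (u W) puts outside of the window [lo, hi] is dominated by
exponentials with parameters u - delta and u + delta. When Gamma'(u) lies
strictly between lo / n and hi / n, both error terms are exponentially negligible
with respect to E exp (u W), because Gamma has slope Gamma'(u) at u.

The remaining input is that independence, stated as a product rule on events,
gives a product rule for expectations
([mutually_independent_integral_prod]). It rests on the change of variables
[ge0_integral_density_map], which is also what integrates against the normal
law. *)

(** * Integration against the image of a measure with density *)

Section density_map.
Import HBNNSimple.

(** Both sides are determined by their values on indicators, where they agree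
by hypothesis: simple functions and monotone convergence do the rest. With
[phi] the identity this integrates against a law with density [w]; with [phi]
a random variable it separates the factor [f \o phi] from the factor [w]. *)
Lemma ge0_integral_density_map d1 d2 (T : measurableType d1)
    (U : measurableType d2) (R : realType) (m : {measure set T -> \bar R})
    (nu : {measure set U -> \bar R}) (phi : T -> U) (w : T -> R) :
    measurable_fun [set: T] phi -> measurable_fun [set: T] w ->
    (forall x, 0 <= w x) ->
    (forall B, measurable B ->
       nu B = (\int[m]_(x in phi @^-1` B) (w x)%:E)%E) ->
  forall f : U -> \bar R, measurable_fun [set: U] f -> (forall y, 0 <= f y)%E ->
  (\int[nu]_y f y = \int[m]_x (f (phi x) * (w x)%:E))%E.
Proof.
move=> mphi mw w0 nuE f mf f0.
pose h := nnsfun_approx measurableT mf.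
have cvgh y : ((h n y)%:E @[n --> \oo] --> f y)%E.
  by apply: cvg_nnsfun_approx => // z _; exact: f0.
have ndh y : {homo (fun n => (h n y)%:E) : n k / (n <= k)%N >-> (n <= k)%E}.
  by move=> n k nk; rewrite lee_fin; exact/lefP/nd_nnsfun_approx.
have mhphi n : measurable_fun setT (fun x => (h n (phi x))%:E).
  by apply/measurable_EFinP; apply: measurableT_comp.
have mwE : measurable_fun setT (fun x => (w x)%:E) by exact/measurable_EFinP.
transitivity (limn (fun n => \int[nu]_y (h n y)%:E)%E).
  rewrite -monotone_convergence//.
  - by apply: eq_integral => y _; apply/esym/cvg_lim.
  - by move=> n; exact/measurable_EFinP.
  - by move=> n y _; rewrite lee_fin.
transitivity (limn (fun n => \int[m]_x ((h n (phi x))%:E * (w x)%:E))%E);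
  last first.
  rewrite -monotone_convergence//.
  - apply: eq_integral => x _; apply/cvg_lim => //.
    by apply: cvgeZr => //; exact: cvgh.
  - by move=> n; exact: emeasurable_funM.
  - by move=> n x _; rewrite mule_ge0 ?lee_fin.
  - move=> x _ n k nk; apply: lee_wpmul2r; first by rewrite lee_fin.
    exact: ndh.
congr (limn _); apply/funext => n.
have mpre r : measurable (phi @^-1` (h n @^-1` [set r])).
  by rewrite -[X in measurable X]setTI; exact: mphi.
under eq_integral do rewrite fimfunE -fsumEFin//.
rewrite ge0_integral_fsum//; last 2 first.
  - by move=> r; exact/measurable_EFinP/measurableT_comp.
  - by move=> r y _; rewrite EFinM nnfun_muleindic_ge0.
have mind r : measurable_fun setT
    (fun x => (r * \1_(h n @^-1` [set r]) (phi x))%:E).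
  apply/measurable_EFinP; apply: measurable_funM => //.
  by apply: measurableT_comp => //; exact: measurable_indic.
under [RHS]eq_integral.
  move=> x _; rewrite fimfunE -fsumEFin// ge0_mule_fsuml; last first.
    by move=> r; rewrite EFinM nnfun_muleindic_ge0.
  over.
rewrite ge0_integral_fsum//; last 2 first.
  - by move=> r; exact: emeasurable_funM.
  - move=> r x _; apply: mule_ge0; last by rewrite lee_fin.
    by rewrite EFinM nnfun_muleindic_ge0.
apply: eq_fsbigr => r /[!inE] -[y0 _ <-].
set s := h n y0.
have s0 : (0 <= s%:E)%E by rewrite lee_fin.
rewrite integralZl_indic_nnsfun// integral_indic// setIT nuE//.
rewrite integral_mkcond -ge0_integralZl//; last 2 first.
  - exact/(measurable_restrictT _ _).1/measurable_funTS.
  - by move=> x _; apply: erestrict_ge0 => z _; rewrite lee_fin.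
apply: eq_integral => x _.
by rewrite epatch_indic EFinM -muleA (muleC (w x)%:E).
Qed.

End density_map.

(** * Expectation of a product of independent variables *)

Lemma bigcap_cons (I : eqType) (U : Type) (F : I -> set U) (i : I)
    (s : seq I) :
  \bigcap_(j in [set` i :: s]) F j = F i `&` \bigcap_(j in [set` s]) F j.
Proof.
rewrite -bigcap_setU1; congr bigcap; apply/seteqP; split=> j /=.
  by rewrite inE => /orP[/eqP ->|js]; [left|right].
by rewrite inE => -[->|->]; rewrite ?eqxx ?orbT.
Qed.

Lemma measurable_bigcap_preimage d (T : measurableType d) (R : realType)
    (I : eqType) (X : I -> {mfun T >-> R}) (B : I -> set R) (s : seq I) :
  (forall i, i \in s -> measurable (B i)) ->
  measurable (\bigcap_(i in [set` s]) (X i @^-1` B i)).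
Proof.
elim: s => [|i s IH] mB; first by rewrite set_nil bigcap_set0.
rewrite bigcap_cons; apply: measurableI.
  by apply: measurable_funPTI => //; apply: mB; rewrite mem_head.
by apply: IH => j js; apply: mB; rewrite inE js orbT.
Qed.

Lemma indic_bigcap_preimage (T U : Type) (R : pzRingType)
    (I : eqType) (X : I -> T -> U) (B : I -> set U) (s : seq I) (w : T) :
  \1_(\bigcap_(i in [set` s]) (X i @^-1` B i)) w =
  \prod_(i <- s) \1_(B i) (X i w) :> R.
Proof.
elim: s => [|i s IH]; first by rewrite set_nil bigcap_set0 big_nil indicT.
by rewrite bigcap_cons big_cons indicI/= IH.
Qed.

(** The factors are split into arbitrary ones, indexed by [s1], and indicators,
indexed by [s2]; the induction on [s1] trades arbitrary factors for
indicators. For no arbitrary factor this is the definition of independence.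
If i is the first index of [s1] and W the product of the other factors, the
induction hypothesis with the factor i replaced by an indicator says that
W integrated over X_i in A is E[W] P(X_i in A), so [ge0_integral_density_map]
applies to the law of X_i scaled by E[W]. *)
Lemma indep_integral_prod_indic (d : measure_display) (T : measurableType d)
    (R : realType) (P : probability T R) (I : eqType) (X : I -> {RV P >-> R}) :
    mutually_independent X ->
  forall (s1 s2 : seq I) (B : I -> set R) (g : I -> R -> R) (c : I -> R),
    uniq (s1 ++ s2) -> (forall i, measurable_fun [set: R] (g i)) ->
    (forall i x, 0 <= g i x) ->
    (forall i, \int[P]_w (g i (X i w))%:E = (c i)%:E)%E ->
    (forall i, i \in s2 -> measurable (B i)) ->
    (forall i, i \in s2 -> g i = \1_(B i)) ->
  (\int[P]_w (\prod_(i <- s1 ++ s2) g i (X i w))%:E =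
     (\prod_(i <- s1 ++ s2) c i)%:E)%E.
Proof.
move=> indepX; elim=> [|i s1 IH] s2 B g c /= us mg g0 gc mB gB.
  transitivity (P (\bigcap_(i in [set` s2]) (X i @^-1` B i))).
    rewrite -[in RHS](setIT (\bigcap_(i in _) _)) -integral_indic//; last first.
      exact: measurable_bigcap_preimage.
    apply: eq_integral => w _; rewrite indic_bigcap_preimage; congr EFin.
    by rewrite big_seq [RHS]big_seq; apply: eq_bigr => i si; rewrite gB.
  rewrite indepX// -prodEFin big_seq [RHS]big_seq; apply: eq_bigr => i si.
  rewrite -gc (gB _ si) -[in LHS](setIT (X i @^-1` _)) -integral_indic//.
  by apply: measurable_funPTI => //; exact: mB.
have /andP[si us'] := us.
have mW : measurable_fun [set: T] (fun w => \prod_(j <- s1 ++ s2) g j (X j w)).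
  by apply: measurable_prod => j _; apply: measurableT_comp.
have c0 j : 0 <= c j.
  by rewrite -lee_fin -gc integral_ge0// => w _; rewrite lee_fin.
have C0 : 0 <= \prod_(j <- s1 ++ s2) c j by rewrite prodr_ge0.
have W0 w : 0 <= \prod_(j <- s1 ++ s2) g j (X j w) by rewrite prodr_ge0.
have mX : measurable_fun [set: T] (X i) by [].
have mgi : measurable_fun [set: R] (EFin \o g i) by exact/measurable_EFinP.
have gi0 y : (0 <= (EFin \o g i) y)%E by rewrite lee_fin.
under eq_integral do rewrite big_cons EFinM.
rewrite -(@ge0_integral_density_map _ _ T _ R P
    (mscale (NngNum C0) (distribution P (X i))) (X i)
    (fun w => \prod_(j <- s1 ++ s2) g j (X j w)) mX mW W0 _ (EFin \o g i))//.
  rewrite ge0_integral_mscale// ge0_integral_distribution//.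
  by rewrite [X in (_ * X)%E]gc /= big_cons EFinM muleC.
move=> A mA.
pose upd U (u : U) (f : I -> U) j := if j == i then u else f j.
pose c' := upd _ (fine (P (X i @^-1` A))) c.
have Ps : perm_eq (s1 ++ i :: s2) (i :: (s1 ++ s2)).
  by rewrite -cat1s perm_catCA cat1s.
have notin j : j \in s1 ++ s2 -> (j == i) = false.
  by move=> js; apply: contraNF si => /eqP <-.
have mXA : measurable (X i @^-1` A) by exact: measurable_funPTI.
have c'E : \prod_(j <- s1 ++ i :: s2) c' j =
    fine (P (X i @^-1` A)) * \prod_(j <- s1 ++ s2) c j.
  rewrite (perm_big _ Ps) big_cons /c' /upd eqxx; congr (_ * _).
  by rewrite big_seq [RHS]big_seq; apply: eq_bigr => j /notin ->.
have := IH (i :: s2) (upd _ A B) (upd _ (\1_A) g) c'; rewrite c'E.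
rewrite mulrC => IH'.
transitivity ((\prod_(j <- s1 ++ s2) c j * fine (P (X i @^-1` A)))%:E).
  by rewrite EFinM fineK ?fin_num_measure.
rewrite -IH'.
- rewrite integral_mkcond; apply: eq_integral => w _.
  rewrite (perm_big _ Ps) big_cons epatch_indic muleC -EFinM /upd eqxx.
  congr (_ * _)%:E.
  by rewrite big_seq [RHS]big_seq; apply: eq_bigr => j /notin ->.
- by rewrite (perm_uniq Ps).
- by move=> j; rewrite /upd; case: ifP => _ //; exact: measurable_indic.
- by move=> j x; rewrite /upd; case: ifP.
- move=> j; rewrite /c' /upd; case: eqP => [->|_]//.
  rewrite fineK ?fin_num_measure//.
  by rewrite -[in RHS](setIT (X i @^-1` _)) -integral_indic.
- move=> j; rewrite inE /upd; case: eqP => [->|_]//=; exact: mB.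
- move=> j; rewrite inE /upd; case: eqP => [->|_]//=; exact: gB.
Qed.

Lemma mutually_independent_integral_prod (d : measure_display)
    (T : measurableType d) (R : realType) (P : probability T R) (I : eqType)
    (X : I -> {RV P >-> R}) (s : seq I) (g : I -> R -> R) (c : I -> R) :
    mutually_independent X -> uniq s ->
    (forall i, measurable_fun [set: R] (g i)) -> (forall i x, 0 <= g i x) ->
    (forall i, \int[P]_w (g i (X i w))%:E = (c i)%:E)%E ->
  (\int[P]_w (\prod_(i <- s) g i (X i w))%:E = (\prod_(i <- s) c i)%:E)%E.
Proof.
move=> indepX us mg g0 gc; rewrite -(cats0 s).
by apply: (@indep_integral_prod_indic _ _ _ _ _ _ indepX s [::] (fun=> set0));
  rewrite ?cats0.
Qed.

(** * Exponential and second moments of the square of a normal variable *)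

Section centered_normal.
Context (d : measure_display) (T : measurableType d) (R : realType).
Variables (P : probability T R) (Y : {RV P >-> R}) (sigma : R).
Hypothesis sigma_gt0 : 0 < sigma.
Hypothesis lawY : forall B : set R, measurable B ->
  distribution P Y B = normal_prob 0 sigma B.

(** Exponential tilting by the square of the variable turns a centered normal
density into another one, up to a constant. *)
Lemma expR_sqr_normal_pdf s x : 2 * s * sigma ^+ 2 < 1 ->
  expR (s * x ^+ 2) * normal_pdf 0 sigma x =
  (1 - 2 * s * sigma ^+ 2) `^ (- 2^-1) *
    normal_pdf 0 (sigma / Num.sqrt (1 - 2 * s * sigma ^+ 2)) x.
Proof.
move=> s1; set q := 1 - _; have q0 : 0 < q by rewrite subr_gt0.
have v0 : sigma / Num.sqrt q != 0 by rewrite gt_eqF// divr_gt0// sqrtr_gt0.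
have sigma0 : sigma != 0 by rewrite gt_eqF.
rewrite (normal_pdfE _ sigma0) (normal_pdfE _ v0) /normal_peak /normal_fun.
rewrite powRN powR12_sqrt ?(ltW q0)// expr_div_n sqr_sqrtr ?(ltW q0)//.
rewrite mulrCA [RHS]mulrA -invfM; congr (_ * _).
  congr (_^-1); rewrite -sqrtrM ?(ltW q0)//; congr Num.sqrt.
  by field; rewrite gt_eqF.
rewrite -expRD; congr expR; rewrite subr0 /q.
by field; rewrite sigma0/= -[X in X != 0]/q gt_eqF.
Qed.

Lemma expectation_expR_sqr_normal s : 2 * s * sigma ^+ 2 < 1 ->
  (\int[P]_w (expR (s * Y w ^+ 2))%:E =
     ((1 - 2 * s * sigma ^+ 2) `^ (- 2^-1))%:E)%E.
Proof.
move=> s1.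
have mexp : measurable_fun [set: R] (fun x => (expR (s * x ^+ 2))%:E).
  by apply/measurable_EFinP; apply: measurableT_comp => //;
    apply: measurable_funM => //; exact: measurable_funX.
rewrite -(@ge0_integral_distribution _ _ _ _ _ P Y
  (fun x => (expR (s * x ^+ 2))%:E))//.
rewrite (@ge0_integral_density_map _ _ (measurableTypeR R) _ R lebesgue_measure
   (distribution P Y) idfun (normal_pdf 0 sigma))//.
- under eq_integral do rewrite /= -EFinM expR_sqr_normal_pdf// EFinM.
  rewrite integralZl//; last exact: integrable_normal_pdf.
  by rewrite integral_normal_pdf mule1.
- exact: measurable_id.
- exact: measurable_normal_pdf.
- by move=> x; exact: normal_pdf_ge0.
Qed.


(** The second moment v is read off from the exponential moments: integrating
1 + s Y^2 <= exp (s Y^2) gives 1 + s v <= (1 - 2 s sigma^2)^(-1/2) for all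
small s of either sign, with equality at s = 0, so the derivatives v and
sigma^2 agree at 0. *)
Lemma expectation_sqr_normal :
  P.-integrable [set: T] (fun w => (Y w ^+ 2)%:E) /\
  (\int[P]_w (Y w ^+ 2)%:E = (sigma ^+ 2)%:E)%E.
Proof.
have sigma2_gt0 : 0 < sigma ^+ 2 by rewrite exprn_gt0.
have mY2 : measurable_fun [set: T] (fun w => Y w ^+ 2).
  exact: measurable_funX.
have mexp s : measurable_fun [set: T] (fun w => expR (s * Y w ^+ 2)).
  by apply: measurableT_comp => //; exact: measurable_funM.
have iexp s : 2 * s * sigma ^+ 2 < 1 ->
    P.-integrable [set: T] (fun w => (expR (s * Y w ^+ 2))%:E).
  move=> s1; apply/integrableP; split; first exact/measurable_EFinP.
  under eq_integral do rewrite gee0_abs ?lee_fin ?expR_ge0//.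
  by rewrite expectation_expR_sqr_normal// ltry.
have iY2 : P.-integrable [set: T] (fun w => (Y w ^+ 2)%:E).
  (* any s with 0 < s < 1 / (2 sigma^2) would do *)
  pose s := (4 * sigma ^+ 2)^-1.
  have s0 : 0 < s by rewrite invr_gt0 mulr_gt0.
  have s1 : 2 * s * sigma ^+ 2 < 1.
    have -> : 2 * s * sigma ^+ 2 = 2^-1 by rewrite /s; field; rewrite gt_eqF.
    lra.
  have := integrableZl measurableT s^-1 (iexp _ s1).
  apply: le_integrable => //; first exact/measurable_EFinP.
  move=> w _ /=; rewrite lee_fin !ger0_norm ?sqr_ge0//; last first.
    apply: mulr_ge0; last exact: expR_ge0.
    by rewrite invr_ge0; exact: ltW.
  rewrite mulrC ler_pdivlMr// mulrC; apply: le_trans (expR_ge1Dx _).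
  by rewrite lerDr.
split => //.
have [v vE] : exists v, (\int[P]_w (Y w ^+ 2)%:E = v%:E)%E.
  exists (fine (\int[P]_w (Y w ^+ 2)%:E)%E).
  by rewrite fineK ?integrable_fin_num.
rewrite vE; congr EFin.
have v0 : 0 <= v.
  by rewrite -lee_fin -vE integral_ge0// => w _; rewrite lee_fin sqr_ge0.
have bound s : 2 * s * sigma ^+ 2 < 1 ->
    1 + s * v <= (1 - 2 * s * sigma ^+ 2) `^ (- 2^-1).
  move=> s1; rewrite -lee_fin -expectation_expR_sqr_normal//.
  have -> : ((1 + s * v)%:E = \int[P]_w (1%:E + s%:E * (Y w ^+ 2)%:E))%E.
    rewrite integralD//=; last 2 first.
    - exact: finite_measure_integrable_cst.
    - exact: integrableZl.
    by rewrite integral_cst//= probability_setT mule1 integralZl// vE.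
  apply: le_integral => //.
  - apply: integrableD => //; first exact: finite_measure_integrable_cst.
    exact: integrableZl.
  - exact: iexp.
  - by move=> w _; rewrite -EFinM -EFinD lee_fin expR_ge1Dx.
pose D := v - sigma ^+ 2.
have [D0|D0] := eqVneq D 0; first by apply/eqP; rewrite -subr_eq0; exact/eqP.
exfalso.
(* Squaring the bound gives 2 s D <= s^2 K for s <= 1, which s = D / M
   contradicts as soon as M > K / 2; the other terms of M keep s small enough
   for the bound to hold and to be squared. *)
pose K := 4 * v * sigma ^+ 2 + 2 * v ^+ 2 * sigma ^+ 2.
have K0 : 0 <= K by rewrite addr_ge0// !mulr_ge0// ?sqr_ge0// ltW.
pose M := 1 + K + `|D| * (1 + 2 * sigma ^+ 2 + v).
have M0 : 0 < M.
  have : 0 <= `|D| * (1 + 2 * sigma ^+ 2 + v).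
    by rewrite mulr_ge0// !addr_ge0// mulr_ge0// ltW.
  rewrite /M; lra.
pose s := D / M.
have absD := ler_norm D; have absND := ler_norm (- D).
rewrite normrN in absND.
have sM : s * M = D by rewrite /s mulfVK ?gt_eqF.
have hyp : 2 * s * sigma ^+ 2 < 1.
  rewrite -(ltr_pM2r M0) mul1r -mulrA (mulrC (sigma ^+ 2)) mulrA -(mulrA 2) sM.
  rewrite /M; nra.
have pos : 0 <= 1 + s * v.
  rewrite -(pmulr_lge0 _ M0) mulrDl mul1r mulrAC sM /M; nra.
have := bound _ hyp.
rewrite -(@ler_pXn2r _ 2)// ?nnegrE ?powR_ge0//.
have q0 : 0 < 1 - 2 * s * sigma ^+ 2 by rewrite subr_gt0.
rewrite powRN powR12_sqrt ?(ltW q0)// exprVn sqr_sqrtr ?(ltW q0)//.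
rewrite -[leRHS]mul1r ler_pdivlMr// => main.
have s2_gt0 : 0 < s ^+ 2.
  by rewrite exprn_even_gt0//= /s mulf_neq0// invr_eq0 gt_eqF.
have s_le1 : s <= 1.
  rewrite -(ler_pM2r M0) mul1r sM /M; nra.
have DE : v = sigma ^+ 2 + s * M by rewrite sM addrC subrK.
have s3 : s ^+ 3 * (2 * v ^+ 2 * sigma ^+ 2) <=
    s ^+ 2 * (2 * v ^+ 2 * sigma ^+ 2).
  apply: ler_wpM2r.
    by rewrite mulr_ge0 ?(ltW sigma2_gt0)// mulr_ge0// sqr_ge0.
  by rewrite exprSr ler_piMr// ltW.
have sv2 : 0 <= s ^+ 2 * v ^+ 2 by rewrite mulr_ge0 ?sqr_ge0.
have : s ^+ 2 * (2 * M) <= s ^+ 2 * K.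
  have -> : s ^+ 2 * (2 * M) = 2 * s * (v - sigma ^+ 2) by rewrite DE; ring.
  have E : (1 + s * v) ^+ 2 * (1 - 2 * s * sigma ^+ 2) =
    1 + 2 * s * (v - sigma ^+ 2) + s ^+ 2 * v ^+ 2
    - s ^+ 2 * (4 * v * sigma ^+ 2)
    - s ^+ 3 * (2 * v ^+ 2 * sigma ^+ 2) by ring.
  rewrite E in main; rewrite /K mulrDr; lra.
rewrite ler_pM2l//; rewrite /M => MK.
have : 0 <= `|D| * (1 + 2 * sigma ^+ 2 + v).
  by rewrite mulr_ge0// !addr_ge0// mulr_ge0// ltW.
lra.
Qed.

End centered_normal.

(** * Exponential rates *)

Lemma lne_expR (R : realType) (x : R) : lne (expR x)%:E = x%:E.
Proof. by rewrite lne_EFin ?expR_gt0// expRK. Qed.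

Lemma mem_itv0y (R : realType) (x : \bar R) : (0 <= x)%E -> x \in `[0%E, +oo%E].
Proof. by move=> x0; rewrite in_itv/= x0 leey. Qed.

Lemma lee_div_lne (R : realType) (n : nat) (x : R) (u : \bar R) :
  (0 < n)%N -> (0 <= u)%E ->
  (x%:E <= (n%:R^-1)%:E * lne u)%E = ((expR (n%:R * x))%:E <= u)%E.
Proof.
move=> n0 u0; rewrite lee_pdivlMl ?ltr0n// -EFinM.
rewrite -[(n%:R * x)%:E in LHS]lne_expR.
by rewrite lee_lne ?mem_itv0y// lee_fin expR_ge0.
Qed.

Lemma div_lne_lee (R : realType) (n : nat) (x : R) (u : \bar R) :
  (0 < n)%N -> (0 <= u)%E ->
  ((n%:R^-1)%:E * lne u <= x%:E)%E = (u <= (expR (n%:R * x))%:E)%E.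
Proof.
move=> n0 u0; rewrite lee_pdivrMl ?ltr0n// -EFinM.
rewrite -[(n%:R * x)%:E in LHS]lne_expR.
by rewrite lee_lne ?mem_itv0y// lee_fin expR_ge0.
Qed.

(** Epsilon form of logarithmic rates, in which they can be multiplied and
compared without logarithms of infinite or null values. *)
Lemma cvg_log_rateP (R : realType) (u : nat -> \bar R) (l : R) :
  (forall n, 0 <= u n)%E ->
  (((n%:R^-1)%:E * lne (u n))%E @[n --> \oo] --> l%:E) <->
  (forall e, 0 < e -> \forall n \near \oo,
     ((expR (n%:R * (l - e)))%:E <= u n <= (expR (n%:R * (l + e)))%:E)%E).
Proof.
move=> u0; split.
- move=> /fine_cvgP[fin /cvgrPdist_le cv] e e0.
  have {}cv := cv _ e0.
  near=> n.
  have n0 : (0 < n)%N by near: n; exact: nbhs_infty_gt.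
  rewrite -lee_div_lne// -div_lne_lee//.
  have fn : ((n%:R^-1)%:E * lne (u n))%E \is a fin_num by near: n.
  have : `|l - fine ((n%:R^-1)%:E * lne (u n))%E| <= e by near: n.
  by rewrite -(fineK fn) !lee_fin distrC ler_distl.
- move=> H.
  have {}H e : 0 < e -> \forall n \near \oo,
     ((l - e)%:E <= (n%:R^-1)%:E * lne (u n) <= (l + e)%:E)%E.
    move=> e0; near=> n.
    have n0 : (0 < n)%N by near: n; exact: nbhs_infty_gt.
    by rewrite lee_div_lne// div_lne_lee//; near: n; exact: H.
  have fin : \forall n \near \oo, ((n%:R^-1)%:E * lne (u n))%E \is a fin_num.
    near=> n.
    have /andP[h1 h2] :
        ((l - 1)%:E <= (n%:R^-1)%:E * lne (u n) <= (l + 1)%:E)%E.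
      by near: n; exact: H.
    by rewrite fin_numElt (lt_le_trans _ h1) ?ltNyr// (le_lt_trans h2) ?ltry.
  apply/fine_cvgP; split => //; apply/cvgrPdist_le => e e0.
  near=> n.
  have fn : ((n%:R^-1)%:E * lne (u n))%E \is a fin_num by near: n.
  have : ((l - e)%:E <= (n%:R^-1)%:E * lne (u n) <= (l + e)%:E)%E.
    by near: n; exact: H.
  by rewrite -(fineK fn) !lee_fin distrC ler_distl.
Unshelve. all: by end_near. Qed.

Lemma is_derive_near_slope (R : realType) (f : R -> R) (x df lo hi : R) :
  is_derive x 1 f df -> lo < df < hi ->
  \forall h \near 0^'+,
    f (x + h) - f x < h * hi /\ f (x - h) - f x < - (h * lo).
Proof.
move=> [fx dfE] /andP[lodf dfhi].
have cv : h^-1 *: ((f \o shift x) (h *: 1) - f x) @[h --> 0^'] --> df.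
  by rewrite -dfE; exact: fx.
have near_slope : \forall h \near 0^',
    lo < h^-1 *: ((f \o shift x) (h *: 1) - f x) < hi.
  near=> h; apply/andP; split; near: h.
    exact: (cvgr_gt df cv).
  exact: (cvgr_lt df cv).
have [r /= r0 Hr] := near_slope.
near=> h.
have h0 : 0 < h by [].
have hr : h < r by near: h; exact: nbhs_right_lt.
split.
- have : lo < h^-1 *: ((f \o shift x) (h *: 1) - f x) < hi.
    apply: Hr; last by rewrite gt_eqF.
    by rewrite /ball_ /= sub0r normrN gtr0_norm.
  move=> /andP[_]; rewrite /= /shift /= scaler1.
  by rewrite -[_ *: _]/(_ * _) ltr_pdivrMl// (addrC h).
- have : lo < (- h)^-1 *: ((f \o shift x) ((- h) *: 1) - f x) < hi.
    apply: Hr; last by rewrite oppr_eq0 gt_eqF.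
    by rewrite /ball_ /= sub0r opprK gtr0_norm.
  move=> /andP[+ _]; rewrite /= /shift /= scaler1.
  rewrite -[_ *: _]/(_ * _) invrN mulNr -mulrN ltr_pdivlMl// (addrC (- h)).
  lra.
Unshelve. all: by end_near. Qed.

(** * Exponential bounds on tail probabilities *)

(** Below [lo] the second term dominates, above [hi] the third one, and in
between the first one: this replaces the change of measure of the usual proof
of the large deviation lower bound. *)
Lemma expR_tilt_le (R : realType) (u delta lo hi W : R) :
  0 <= delta -> 0 <= u ->
  expR (u * W) <= expR (u * hi) * (lo <= W)%R%:R
    + expR (delta * lo) * expR ((u - delta) * W)
    + expR (- (delta * hi)) * expR ((u + delta) * W).
Proof.
move=> delta0 u0; rewrite -!expRD.
have p1 := expR_ge0 (u * hi).
have p2 := expR_ge0 (delta * lo + (u - delta) * W).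
have p3 := expR_ge0 (- (delta * hi) + (u + delta) * W).
have [loW|Wlo] := leP lo W; rewrite ?mulr1 ?mulr0 ?add0r.
  have [Whi|hiW] := leP W hi.
    have : expR (u * W) <= expR (u * hi) by rewrite ler_expR ler_wpM2l.
    lra.
  have : expR (u * W) <= expR (- (delta * hi) + (u + delta) * W).
    rewrite ler_expR; have := ler_wpM2l delta0 (ltW hiW); lra.
  lra.
have : expR (u * W) <= expR (delta * lo + (u - delta) * W).
  rewrite ler_expR; have := ler_wpM2l delta0 (ltW Wlo); lra.
lra.
Qed.

Section exponential_tail.
Context (d : measure_display) (T : measurableType d) (R : realType).
Variables (P : probability T R) (W : T -> R).
Hypothesis mW : measurable_fun [set: T] W.

Let mgf s : \bar R := (\int[P]_w (expR (s * W w))%:E)%E.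

Let mexp s : measurable_fun [set: T] (fun w => (expR (s * W w))%:E).
Proof.
apply/measurable_EFinP; apply: measurableT_comp => //.
exact: measurable_funM.
Qed.

Lemma measurable_superlevel lo : measurable [set w | (lo <= W w)%R].
Proof.
have -> : [set w | (lo <= W w)%R] = [set: T] `&` W @^-1` `[lo, +oo[%classic.
  by apply/seteqP; split=> w /=; rewrite in_itv/= andbT => // -[].
exact: mW.
Qed.

Let in_superlevel lo w : (w \in [set w | (lo <= W w)%R]) = (lo <= W w).
Proof. by apply/idP/idP; rewrite inE. Qed.

Lemma exponential_markov s lo : 0 <= s ->
  ((expR (s * lo))%:E * P [set w | (lo <= W w)%R] <= mgf s)%E.
Proof.
move=> s0; rewrite -[X in P X]setIT -integral_indic//; last first.
  exact: measurable_superlevel.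
rewrite -ge0_integralZl//; last first.
  exact/measurable_EFinP/measurable_indic/measurable_superlevel.
apply: ge0_le_integral => //.
- apply: measurable_funeM.
  exact/measurable_EFinP/measurable_indic/measurable_superlevel.
- move=> w _; rewrite -EFinM lee_fin indicE in_superlevel.
  case: (boolP (lo <= W w)) => h; last by rewrite mulr0 expR_ge0.
  by rewrite mulr1 ler_expR ler_wpM2l.
Qed.

Lemma tilted_tail_lower_bound u delta lo hi : 0 <= delta -> 0 <= u ->
  (mgf u <= (expR (u * hi))%:E * P [set w | (lo <= W w)%R]
     + (expR (delta * lo))%:E * mgf (u - delta)
     + (expR (- (delta * hi)))%:E * mgf (u + delta))%E.
Proof.
move=> delta0 u0; rewrite -[X in P X]setIT -integral_indic//; last first.
  exact: measurable_superlevel.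
have mind : measurable_fun [set: T]
    (fun w => (\1_[set w | (lo <= W w)%R] w : R)%:E).
  exact/measurable_EFinP/measurable_indic/measurable_superlevel.
rewrite -!ge0_integralZl//.
rewrite -!ge0_integralD//; last 5 first.
- by move=> w _; rewrite adde_ge0 ?mule_ge0 ?lee_fin ?expR_ge0.
- by apply: emeasurable_funD; exact: measurable_funeM.
- exact: measurable_funeM.
- exact: measurable_funeM.
- exact: measurable_funeM.
apply: ge0_le_integral => //.
- by do 2 (apply: emeasurable_funD; last exact: measurable_funeM);
    exact: measurable_funeM.
move=> w _; have := @expR_tilt_le _ u delta lo hi (W w) delta0 u0.
by rewrite -!EFinM -!EFinD lee_fin indicE in_superlevel.
Qed.

End exponential_tail.

(** * The Gaertner-Ellis theorem on a half line *)

Section gartner_ellis.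
Context (d : measure_display) (T : measurableType d) (R : realType).
Variables (P : probability T R) (W : nat -> T -> R).
Hypothesis mW : forall n, measurable_fun [set: T] (W n).

Let mgf n s : \bar R := (\int[P]_w (expR (s * W n w))%:E)%E.

Let mgf_ge0 s n : (0 <= mgf n s)%E.
Proof. by apply: integral_ge0 => w _; rewrite lee_fin expR_ge0. Qed.

Let has_rate (Gamma : R -> R) s :=
  ((n%:R^-1)%:E * lne (mgf n s))%E @[n --> \oo] --> (Gamma s)%:E.

Let A b n := [set w | (n%:R * b <= W n w)%R].

Lemma tail_rate_upper (Gamma : R -> R) (s b e : R) :
  0 <= s -> has_rate Gamma s -> 0 < e ->
  \forall n \near \oo,
    (P (A b n) <= (expR (n%:R * (Gamma s - s * b + e)))%:E)%E.
Proof.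
move=> s0 rate e0.
have {}rate := (cvg_log_rateP _ (mgf_ge0 s)).1 rate _ e0.
near=> n.
have /andP[_ ub] : ((expR (n%:R * (Gamma s - e)))%:E <= mgf n s <=
    (expR (n%:R * (Gamma s + e)))%:E)%E by near: n.
have := le_trans (exponential_markov P (mW n) (n%:R * b) s0) ub.
rewrite -lee_pdivlMl ?expR_gt0// => /le_trans; apply.
rewrite -EFinM lee_fin -expRN -expRD ler_expR; lra.
Unshelve. all: by end_near. Qed.

(** Tilting by [u] concentrates W_n / n around the slope of Gamma at [u]: the
slope is strictly between [b] and [hi], so the two error terms of
[tilted_tail_lower_bound] have rates below Gamma(u) for small [delta]. *)
Lemma tail_rate_lower (Gamma : R -> R) (u dG b hi e : R) :
  0 <= u -> (\forall s \near u, has_rate Gamma s) ->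
  is_derive u 1 Gamma dG -> b < dG < hi -> 0 < e ->
  \forall n \near \oo,
    ((expR (n%:R * (Gamma u - u * hi - e)))%:E <= P (A b n))%E.
Proof.
move=> u0 rate dGamma bdGhi e0.
have slope := is_derive_near_slope dGamma bdGhi.
have [delta [delta0 rateL rateR [slopeR slopeL]]] : exists delta, [/\ 0 < delta,
    has_rate Gamma (u - delta), has_rate Gamma (u + delta) &
    Gamma (u + delta) - Gamma u < delta * hi /\
    Gamma (u - delta) - Gamma u < - (delta * b)].
  have [r /= r0 Hr] := rate.
  have /filter_ex[h [h0 hr hs]] : \forall h \near 0^'+, [/\ 0 < h, h < r &
      Gamma (u + h) - Gamma u < h * hi /\ Gamma (u - h) - Gamma u < - (h * b)].
    near=> h; split.
    - by [].
    - by near: h; exact: nbhs_right_lt.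
    - by near: h.
  exists h; split => //; apply: Hr; rewrite /ball_ /= opprD addNKr ?opprK.
    by rewrite gtr0_norm.
  by rewrite normrN gtr0_norm.
pose E1 := - (delta * b) - (Gamma (u - delta) - Gamma u).
pose E2 := delta * hi - (Gamma (u + delta) - Gamma u).
have E10 : 0 < E1 by rewrite subr_gt0.
have E20 : 0 < E2 by rewrite subr_gt0.
(* both error terms then have rate at most Gamma(u) - 3 eta *)
pose eta := Num.min (e / 2) (Num.min (E1 / 4) (E2 / 4)).
have eta0 : 0 < eta by rewrite /eta !lt_min !divr_gt0.
have [eta_e eta_E1 eta_E2] : [/\ eta <= e / 2, eta <= E1 / 4 & eta <= E2 / 4].
  by rewrite /eta !ge_min !lexx !orbT.
have ratem := (cvg_log_rateP _ (mgf_ge0 u)).1 (nbhs_singleton rate) _ eta0.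
have {}rateL := (cvg_log_rateP _ (mgf_ge0 (u - delta))).1 rateL _ eta0.
have {}rateR := (cvg_log_rateP _ (mgf_ge0 (u + delta))).1 rateR _ eta0.
near=> n.
have /andP[lb _] : ((expR (n%:R * (Gamma u - eta)))%:E <= mgf n u <=
    (expR (n%:R * (Gamma u + eta)))%:E)%E by near: n.
have /andP[_ ubL] : ((expR (n%:R * (Gamma (u - delta) - eta)))%:E <=
    mgf n (u - delta) <= (expR (n%:R * (Gamma (u - delta) + eta)))%:E)%E.
  by near: n.
have /andP[_ ubR] : ((expR (n%:R * (Gamma (u + delta) - eta)))%:E <=
    mgf n (u + delta) <= (expR (n%:R * (Gamma (u + delta) + eta)))%:E)%E.
  by near: n.
have n_large : eta^-1 <= n%:R by near: n; exact: nbhs_infty_ger.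
have n_eta : 1 <= n%:R * eta by rewrite -ler_pdivrMr// div1r.
have n0 : 0 <= n%:R :> R by [].
have mA : measurable (A b n) by exact: measurable_superlevel.
have [p pE] : exists p, P (A b n) = p%:E.
  by exists (fine (P (A b n))); rewrite fineK ?fin_num_measure.
have := tilted_tail_lower_bound P (mW n) (n%:R * b) (n%:R * hi) (ltW delta0) u0.
rewrite -/(mgf n u) -/(mgf n (u - delta)) -/(mgf n (u + delta)) -/(A b n).
rewrite pE => /(le_trans lb) main.
have : ((expR (n%:R * (Gamma u - eta)))%:E <= (expR (u * (n%:R * hi)))%:E * p%:E
   + (expR (delta * (n%:R * b)))%:E * (expR (n%:R * (Gamma (u - delta) + eta)))%:E
   + (expR (- (delta * (n%:R * hi))))%:E *
       (expR (n%:R * (Gamma (u + delta) + eta)))%:E)%E.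
  apply: (le_trans main); apply: leeD; first apply: leeD => //.
    by apply: lee_wpmul2l => //; rewrite lee_fin expR_ge0.
  by apply: lee_wpmul2l => //; rewrite lee_fin expR_ge0.
rewrite -!EFinM -!EFinD !lee_fin -!expRD => {}main.
have tailL : expR (delta * (n%:R * b) + n%:R * (Gamma (u - delta) + eta)) <=
    expR (n%:R * (Gamma u - 3 * eta)).
  rewrite ler_expR.
  have -> : delta * (n%:R * b) + n%:R * (Gamma (u - delta) + eta) =
    n%:R * (Gamma u - E1 + eta) by rewrite /E1; ring.
  apply: ler_wpM2l => //; lra.
have tailR : expR (- (delta * (n%:R * hi)) + n%:R * (Gamma (u + delta) + eta)) <=
    expR (n%:R * (Gamma u - 3 * eta)).
  rewrite ler_expR.
  have -> : - (delta * (n%:R * hi)) + n%:R * (Gamma (u + delta) + eta) =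
    n%:R * (Gamma u - E2 + eta) by rewrite /E2; ring.
  apply: ler_wpM2l => //; lra.
pose x := expR (- (n%:R * eta)).
pose y := expR (n%:R * (Gamma u - eta)).
have x0 : 0 < x by exact: expR_gt0.
have y0 : 0 < y by exact: expR_gt0.
have x_half : x <= 2^-1.
  rewrite /x expRN lef_pV2 ?posrE ?expR_gt0//.
  by apply: le_trans (expR_ge1Dx _); lra.
have tailE : expR (n%:R * (Gamma u - 3 * eta)) = y * x ^+ 2.
  by rewrite /y /x -expRM_natl -expRD; congr expR; ring.
have xy : y * x <= expR (u * (n%:R * hi)) * p.
  rewrite tailE in tailL tailR; rewrite -/y in main.
  suff : y * x + 2 * (y * x ^+ 2) <= y by lra.
  rewrite -[leRHS]mulr1 mulrCA -mulrDr ler_pM2l//; nra.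
have xyE : y * x = expR (n%:R * (Gamma u - 2 * eta)).
  by rewrite /y /x -expRD; congr expR; ring.
rewrite -(ler_pM2l (expR_gt0 (u * (n%:R * hi)))).
apply: le_trans xy; rewrite xyE -expRD ler_expR.
have -> : u * (n%:R * hi) + n%:R * (Gamma u - u * hi - e) =
  n%:R * (Gamma u - e) by ring.
by apply: ler_wpM2l => //; lra.
Unshelve. all: by end_near. Qed.

(** The lower bound uses tilts [u] slightly above [s0], for which the slope of
Gamma is strictly above the threshold; they tend to [s0] and the rates to
the Legendre value at [s0] by continuity. *)
Lemma gartner_ellis_half_line (Gamma dGamma : R -> R) (s0 : R) :
  0 < s0 ->
  (\forall s \near s0, has_rate Gamma s) ->
  (\forall s \near s0, is_derive (s : R) (1 : R) Gamma (dGamma s)) ->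
  {for s0, continuous dGamma} ->
  (\forall s \near s0^'+, dGamma s0 < dGamma s) ->
  ((n%:R^-1)%:E * lne (P (A (dGamma s0) n)))%E @[n --> \oo] -->
    (Gamma s0 - s0 * dGamma s0)%:E.
Proof.
move=> s0_gt0 rate dG cdG incr; set b := dGamma s0.
apply/cvg_log_rateP => [n|e e0]; first exact: measure_ge0.
have up := tail_rate_upper b (ltW s0_gt0) (nbhs_singleton rate) e0.
pose eta := e / (4 * (s0 + 1)).
have eta0 : 0 < eta by rewrite divr_gt0// mulr_gt0// addr_gt0.
have cG : (Gamma s - s * b) @[s --> s0] --> Gamma s0 - s0 * b.
  apply: cvgB; last by apply: cvgMl; exact: cvg_id.
  have [/derivable1_diffP /differentiable_continuous] := nbhs_singleton dG.
  by [].
have /filter_ex[u [u_gt u_lt rate_u [dG_u b_u u_hi Gu]]] :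
    \forall u \near s0^'+, [/\ s0 < u, u < s0 + 1,
      \forall s \near u, has_rate Gamma s & [/\ is_derive u 1 Gamma (dGamma u),
      b < dGamma u, dGamma u < b + eta &
      Gamma s0 - s0 * b - e / 4 <= Gamma u - u * b]].
  have right (Q : set R) : (\forall u \near s0, Q u) ->
      \forall u \near s0^'+, Q u by exact: cvg_within.
  near=> u; split; last split.
  - by [].
  - by near: u; apply: nbhs_right_lt; rewrite ltrDl.
  - by near: u; apply: right; exact: near_join.
  - by near: u; exact: right.
  - by near: u.
  - by near: u; apply: right; apply: (cvgr_lt _ cdG); rewrite ltrDl.
  - near: u; apply: right; apply: (cvgr_ge _ cG).
    by rewrite gtrBl divr_gt0.
have u0 : 0 <= u by apply: ltW; apply: lt_trans u_gt.
have b_dG : b < dGamma u < b + eta by rewrite b_u.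
have e4 : 0 < e / 4 by rewrite divr_gt0.
have low := tail_rate_lower u0 rate_u dG_u b_dG e4.
near=> n; apply/andP; split.
  have : ((expR (n%:R * (Gamma u - u * (b + eta) - e / 4)))%:E <=
    P (A b n))%E by near: n.
  apply: le_trans; rewrite lee_fin ler_expR; apply: ler_wpM2l => //.
  have : u * eta <= e / 4.
    have -> : e / 4 = (s0 + 1) * eta.
      by rewrite /eta; field; rewrite gt_eqF// addr_gt0.
    by rewrite ler_pM2r// ltW.
  lra.
by near: n.
Unshelve. all: by end_near. Qed.

End gartner_ellis.

(** * The log-likelihood ratio as a sum *)

Lemma invmx_diag (F : fieldType) (n : nat) (v : 'rV[F]_n) :
  (forall i, v 0 i != 0) -> invmx (diag_mx v) = diag_mx (\row_i (v 0 i)^-1).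
Proof.
move=> v0.
have vV : diag_mx v *m diag_mx (\row_i (v 0 i)^-1) = 1%:M.
  rewrite mulmx_diag -diag_const_mx; congr diag_mx; apply/rowP => i.
  by rewrite !mxE divff.
have [vU _] := mulmx1_unit vV.
by rewrite -[LHS]mulmx1 -vV mulmxA mulVmx// mul1mx.
Qed.

Lemma ln_prod (R : realType) (I : Type) (s : seq I) (v : I -> R) :
  (forall i, 0 < v i) -> ln (\prod_(i <- s) v i) = \sum_(i <- s) ln (v i).
Proof.
move=> v0; elim: s => [|i s IH]; first by rewrite !big_nil ln1.
by rewrite !big_cons lnM ?IH ?posrE ?prodr_gt0.
Qed.

Lemma ln_sqrt (R : realType) (x : R) : 0 < x -> ln (Num.sqrt x) = ln x / 2.
Proof. by move=> x0; rewrite -powR12_sqrt ?ltW// ln_powR mulrC. Qed.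

Lemma mvnormal_pdf_diag_gt0 (R : realType) (n : nat) (v x : 'rV[R]_n) :
  (forall i, 0 < v 0 i) -> 0 < mvnormal_pdf 0 (diag_mx v) x.
Proof.
move=> v0; rewrite /mvnormal_pdf mulr_gt0 ?expR_gt0// invr_gt0 sqrtr_gt0.
by rewrite det_diag mulr_gt0 ?exprn_gt0 ?mulr_gt0 ?pi_gt0 ?prodr_gt0.
Qed.

Lemma ln_mvnormal_pdf_diag (R : realType) (n : nat) (v x : 'rV[R]_n) :
  (forall i, 0 < v 0 i) ->
  ln (mvnormal_pdf 0 (diag_mx v) x) =
  - (ln ((2 * pi) ^+ n) / 2)
  - \sum_(i < n) (ln (v 0 i) / 2 + x 0 i ^+ 2 / (2 * v 0 i)).
Proof.
move=> v0; have v_neq0 i : v 0 i != 0 by rewrite gt_eqF.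
have pi0 : 0 < (2 * pi) ^+ n :> R by rewrite exprn_gt0// mulr_gt0// pi_gt0.
have det0 : 0 < \prod_i v 0 i by rewrite prodr_gt0.
rewrite /mvnormal_pdf det_diag invmx_diag// subr0.
rewrite lnM ?posrE ?expR_gt0 ?invr_gt0 ?sqrtr_gt0 ?mulr_gt0// expRK.
rewrite lnV ?posrE ?sqrtr_gt0 ?mulr_gt0// ln_sqrt ?mulr_gt0//.
rewrite lnM ?posrE// ln_prod// big_split/= -mulr_suml mulrDl !opprD -addrA.
congr (_ + (_ + _)); congr (- _).
rewrite mul_mx_diag mxE mulr_suml; apply: eq_bigr => i _.
by rewrite !mxE; field; exact: v_neq0.
Qed.

Lemma log_lr_sum (T : Type) (R : realType) (X : nat -> T -> R)
    (sigma tau beta : R) (n : nat) (w : T) : 0 < sigma -> 0 < tau ->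
  log_lr X sigma tau beta n w =
  \sum_(i < n) (if (i < Num.truncn (beta * n%:R))%N then 0 else
     ln (sigma / tau) + ((sigma ^- 2 - tau ^- 2) / 2) * X i w ^+ 2).
Proof.
move=> sigma0 tau0; have sigma2 : 0 < sigma ^+ 2 by rewrite exprn_gt0.
have tau2 : 0 < tau ^+ 2 by rewrite exprn_gt0.
rewrite /log_lr /change_pdf /null_pdf /change_cov -diag_const_mx.
set v := \row_i _; set u := const_mx _.
have v0 i : 0 < v 0 i by rewrite mxE; case: ifP.
have u0 i : 0 < u 0 i by rewrite mxE.
rewrite ln_div ?posrE ?mvnormal_pdf_diag_gt0// !ln_mvnormal_pdf_diag//.
rewrite opprB addrC addrA subrK -sumrB; apply: eq_bigr => i _.
rewrite !mxE; case: ifP => _; first by rewrite subrr.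
rewrite ln_div ?posrE// !lnXn// -!(mulr_natr (ln _)).
by field; rewrite !gt_eqF.
Qed.

(** * Moments of the log-likelihood ratio *)

Section log_likelihood_ratio.
Context (d : measure_display) (T : measurableType d) (R : realType).
Variables (P : probability T R) (X : nat -> {RV P >-> R}).
Variables (sigma tau beta : R).
Hypotheses (sigma_gt0 : 0 < sigma) (tau_gt0 : 0 < tau).
Hypotheses (beta_ge0 : 0 <= beta) (beta_le1 : beta <= 1).
Hypothesis X_iid : iid_centered_normal X sigma.

Let k n := Num.truncn (beta * n%:R).

Let L := ln (sigma / tau).
Let c := (sigma ^- 2 - tau ^- 2) / 2.

Lemma truncn_frac_le n : (k n <= n)%N.
Proof.
rewrite -(ler_nat R) (le_trans (y := beta * n%:R))//.
  by rewrite truncn_le mulr_ge0.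
by rewrite ler_piMl.
Qed.

Lemma sum_after_change (V : nmodType) n (x : V) :
  \sum_(i < n) (if (i < k n)%N then 0 else x) = x *+ (n - k n).
Proof.
rewrite -(big_mkord predT (fun i => if (i < k n)%N then 0 else x)).
rewrite (big_cat_nat (n := k n))//= ?truncn_frac_le//.
rewrite big_nat big1 ?add0r => [|i /andP[_ ->]//].
rewrite big_nat (eq_bigr (fun=> x)) -?big_nat ?sumr_const_nat// => i /andP[ki _].
by rewrite ltnNge ki.
Qed.

Let log_lrE n : (fun w => log_lr X sigma tau beta n w) = (fun w =>
  \sum_(i < n) (if (i < k n)%N then 0 else L + c * X i w ^+ 2)).
Proof. by apply/funext => w; exact: log_lr_sum. Qed.

Lemma measurable_log_lr n :
  measurable_fun [set: T] (fun w => log_lr X sigma tau beta n w).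
Proof.
rewrite log_lrE.
apply: measurable_sum => i; case: (i < k n)%N => //.
apply: measurable_funD => //; apply: measurable_funM => //.
exact: measurable_funX.
Qed.

Lemma mgf_log_lr n s : 2 * s * (c * sigma ^+ 2) < 1 ->
  (\int[P]_w (expR (s * log_lr X sigma tau beta n w))%:E =
  (expR ((n - k n)%:R * (s * L - ln (1 - 2 * s * (c * sigma ^+ 2)) / 2)))%:E)%E.
Proof.
move=> s1; have [indepX lawX] := X_iid; set q := 1 - _.
have q0 : 0 < q by rewrite subr_gt0.
pose g (i : nat) x := expR (if (i < k n)%N then 0 else s * (L + c * x ^+ 2)).
pose C (i : nat) := expR (if (i < k n)%N then 0 else s * L - ln q / 2).
under eq_integral => w _.
  rewrite (congr1 (fun f => f w) (log_lrE n)) mulr_sumr expR_sum.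
  rewrite (eq_bigr (fun i : 'I_n => g i (X i w))); last first.
    by move=> i _; rewrite /g; case: ifP => _; rewrite ?mulr0.
  rewrite -(big_mkord predT (fun i => g i (X i w))).
  over.
rewrite (@mutually_independent_integral_prod _ _ _ _ _ _ _ g C)//.
- rewrite big_mkord -expR_sum sum_after_change.
  by rewrite mulr_natl.
- exact: iota_uniq.
- move=> i; rewrite /g; apply: measurableT_comp => //; case: (i < k n)%N => //.
  apply: measurable_funM => //; apply: measurable_funD => //.
  by apply: measurable_funM => //; exact: measurable_funX.
- by move=> i x; exact: expR_ge0.
- move=> i; rewrite /g /C; case: (i < k n)%N.
    by rewrite integral_cst//= probability_setT mule1.
  under eq_integral do rewrite mulrDr expRD EFinM mulrA.
  have s1' : 2 * (s * c) * sigma ^+ 2 < 1 by rewrite !mulrA in s1 *.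
  rewrite ge0_integralZl//; last first.
    apply/measurable_EFinP; apply: measurableT_comp => //.
    by apply: measurable_funM => //; exact: measurable_funX.
  rewrite (expectation_expR_sqr_normal sigma_gt0 (lawX i) s1') -EFinM.
  rewrite expRD; congr (_ * _)%:E.
  rewrite /powR ifF; last by apply/eqP; move: q0; rewrite /q !mulrA; lra.
  by congr expR; rewrite /q !mulrA mulNr mulrC.
Qed.

Lemma expectation_log_lr n :
  ('E_P[log_lr X sigma tau beta n] =
     ((n - k n)%:R * (L + c * sigma ^+ 2))%R%:E)%E.
Proof.
have [_ lawX] := X_iid.
have iX i : P.-integrable [set: T] (fun w => (X i w ^+ 2)%:E).
  by have [] := expectation_sqr_normal sigma_gt0 (lawX i).
have EX i : (\int[P]_w (X i w ^+ 2)%:E = (sigma ^+ 2)%:E)%E.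
  by have [] := expectation_sqr_normal sigma_gt0 (lawX i).
rewrite [log_lr X sigma tau beta n]log_lrE unlock.
under eq_integral do rewrite -sumEFin.
rewrite integral_sum//; last first.
  move=> i; case: (i < k n)%N.
    exact: finite_measure_integrable_cst.
  under eq_fun do rewrite EFinD EFinM.
  apply: integrableD => //; first exact: finite_measure_integrable_cst.
  exact: integrableZl.
rewrite (eq_bigr (fun i : 'I_n =>
    (if (i < k n)%N then 0 else L + c * sigma ^+ 2)%:E)); last first.
  move=> i _; case: (i < k n)%N; first by rewrite integral_cst//= mul0e.
  under eq_integral do rewrite EFinD EFinM.
  rewrite integralD//; last 2 first.
  - exact: finite_measure_integrable_cst.
  - exact: integrableZl.
  by rewrite integral_cst//= probability_setT mule1 integralZl// EX.
by rewrite sumEFin sum_after_change mulr_natl.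
Qed.

Lemma cvg_frac_after_change :
  ((n - k n)%:R / n%:R : R) @[n --> \oo] --> 1 - beta.
Proof.
have inv0 : (n%:R^-1 : R) @[n --> \oo] --> 0.
  apply/gtr0_cvgV0; last exact: cvgr_idn.
  by near do rewrite ltr0n; exact: nbhs_infty_gt.
have up : (1 - beta + n%:R^-1 : R) @[n --> \oo] --> 1 - beta.
  by rewrite -[X in _ --> X]addr0; apply: cvgD => //; exact: cvg_cst.
apply: squeeze_cvgr (cvg_cst _) up.
near=> n.
have n0 : 0 < n%:R :> R by rewrite ltr0n; near: n; exact: nbhs_infty_gt.
have bn : 0 <= beta * n%:R by rewrite mulr_ge0.
rewrite ler_pdivlMr// ler_pdivrMr// natrB ?truncn_frac_le//.
have nV : n%:R^-1 * n%:R = 1 :> R by rewrite mulVf ?gt_eqF.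
rewrite [(1 - beta + _) * _]mulrDl nV.
have /andP[] := truncn_itv bn; rewrite -/(k n) -natr1; lra.
Unshelve. all: by end_near. Qed.

End log_likelihood_ratio.

(** * The limiting scaled cumulant generating function *)

Section scaled_log_mgf.
Context (R : realType).
Variables (beta L a : R).
Hypothesis beta_lt1 : beta < 1.
Hypothesis a_neq0 : a != 0.

Definition log_mgf s := (1 - beta) * (s * L - ln (1 - 2 * s * a) / 2).
Definition dlog_mgf s := (1 - beta) * (L + a / (1 - 2 * s * a)).

Let cvg_arg (s : R) : (1 - 2 * t * a : R) @[t --> s] --> 1 - 2 * s * a.
Proof.
apply: cvgB; first exact: cvg_cst.
by apply: cvgMl; apply: cvgMr; exact: cvg_id.
Qed.

Lemma near_log_mgf_dom (s : R) :
  2 * s * a < 1 -> \forall t \near s, 2 * t * a < 1.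
Proof.
rewrite -subr_gt0 => s1; near=> t; rewrite -subr_gt0; near: t.
exact: (cvgr_gt _ (@cvg_arg s)).
Unshelve. all: by end_near. Qed.

Lemma is_derive_log_mgf (s : R) : 2 * s * a < 1 ->
  is_derive s (1 : R) log_mgf (dlog_mgf s).
Proof.
rewrite -subr_gt0 => q0.
have dln : is_derive (1 - 2 * s * a) (1 : R) (@ln R) (1 - 2 * s * a)^-1.
  exact: is_derive1_ln.
have dq : is_derive s (1 : R) (fun t : R => 1 - 2 * t * a) (- (2 * a)).
  have -> : (fun t => 1 - 2 * t * a) = cst 1 + (- (2 * a)) \*: id.
    by apply/funext => t; rewrite !fctE /= -[_ *: _]/(_ * _); ring.
  by apply: is_derive_eq; rewrite add0r -[_ *: _]/(_ * _) mulr1.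
have -> : log_mgf = (1 - beta) \*:
    (L \*: id - 2^-1 \*: (@ln R \o (fun t => 1 - 2 * t * a))).
  by apply/funext => t; rewrite !fctE /= -![_ *: _]/(_ * _) /log_mgf; ring.
apply: is_derive_eq; rewrite -![_ *: _]/(_ * _) /dlog_mgf.
by field; rewrite gt_eqF.
Qed.

Lemma continuous_dlog_mgf (s : R) :
  2 * s * a < 1 -> {for s, continuous dlog_mgf}.
Proof.
rewrite -subr_gt0 => q0.
apply: cvgMr; apply: cvgD; first exact: cvg_cst.
apply: cvgMr; apply: cvgV; last exact: cvg_arg.
by rewrite gt_eqF.
Qed.

Lemma dlog_mgf_lt s t : 2 * s * a < 1 -> 2 * t * a < 1 -> s < t ->
  dlog_mgf s < dlog_mgf t.
Proof.
rewrite -subr_gt0 -(subr_gt0 _ 1) => qs qt st.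
rewrite ltr_pM2l ?subr_gt0// ltrD2l -subr_gt0.
have -> : a / (1 - 2 * t * a) - a / (1 - 2 * s * a) =
    2 * a ^+ 2 * (t - s) / ((1 - 2 * t * a) * (1 - 2 * s * a)).
  by field; rewrite !gt_eqF.
have a2 : 0 < a ^+ 2 by rewrite exprn_even_gt0.
by rewrite divr_gt0// mulr_gt0// ?subr_gt0// mulr_gt0.
Qed.

End scaled_log_mgf.

(** * Large deviations of the log-likelihood ratio *)

Theorem mainTheorem3 (R : realType) (d : measure_display)
    (T : measurableType d) (P0 : probability T R) (X : nat -> {RV P0 >-> R})
    (sigma tau beta gamma b : R)
    (sigma_gt0 : 0 < sigma) (tau_gt0 : 0 < tau) (sigma_neq_tau : sigma <> tau)
    (beta_ge0 : 0 <= beta) (beta_lt1 : beta < 1) (gamma_gt0 : 0 < gamma)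
    (X_iid : iid_centered_normal X sigma)
    (b_gt_mean :
      (limn (fun n : nat =>
         (n%:R^-1)%:E * 'E_P0[log_lr X sigma tau beta n]) < b%:E)%E)
    (arg_gt0 :
      0 < - 2 * tau ^+ 2 / (sigma ^+ 2 - tau ^+ 2) *
          (b / (1 - beta) - ln (sigma / tau)))
    (gammaE :
      gamma = (1 - beta) *
        (- (1 / 2)
         - tau ^+ 2 / (sigma ^+ 2 - tau ^+ 2) *
             (b / (1 - beta) - ln (sigma / tau))
         - 1 / 2 * ln (- 2 * tau ^+ 2 / (sigma ^+ 2 - tau ^+ 2) *
             (b / (1 - beta) - ln (sigma / tau))))) :
  ((n%:R^-1)%:E *
     lne (P0 [set w | (b <= n%:R^-1 * log_lr X sigma tau beta n w)%R]))%E
    @[n --> \oo] --> (- gamma)%:E.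
Proof.
have beta_le1 := ltW beta_lt1.
set L := ln (sigma / tau) in arg_gt0 gammaE.
pose a := (sigma ^- 2 - tau ^- 2) / 2 * sigma ^+ 2.
have tau2 : tau ^+ 2 != 0 by rewrite gt_eqF// exprn_gt0.
have sub_neq0 : sigma ^+ 2 - tau ^+ 2 != 0.
  rewrite subr_sqr mulf_neq0//; last by rewrite gt_eqF// addr_gt0.
  by rewrite subr_eq0; exact/eqP.
have aE : a = - (sigma ^+ 2 - tau ^+ 2) / (2 * tau ^+ 2).
  by rewrite /a; field; rewrite !gt_eqF.
have a0 : a != 0.
  by rewrite aE mulf_neq0// ?oppr_eq0// invr_eq0 mulf_neq0.
have aV : - 2 * tau ^+ 2 / (sigma ^+ 2 - tau ^+ 2) = a^-1.
  by rewrite aE; field; rewrite sub_neq0 gt_eqF.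
have beta1 : 0 < 1 - beta by rewrite subr_gt0.
set t := - 2 * tau ^+ 2 / (sigma ^+ 2 - tau ^+ 2) * (b / (1 - beta) - L)
  in arg_gt0 gammaE.
have tE : t = a^-1 * (b / (1 - beta) - L) by rewrite /t aV.
have bE : b = (1 - beta) * (L + a * t).
  by rewrite tE; field; rewrite a0 gt_eqF.
have gammaE' : gamma = (1 - beta) * ((t - 1 - ln t) / 2).
  rewrite gammaE; congr (_ * _).
  have -> : tau ^+ 2 / (sigma ^+ 2 - tau ^+ 2) * (b / (1 - beta) - L) =
      - (t / 2).
    by rewrite /t; field; rewrite sub_neq0 gt_eqF.
  lra.
(* the limit of the mean is (1 - beta) (L + a) *)
have mean_lt : (1 - beta) * (L + a) < b.
  rewrite -lte_fin; apply: le_lt_trans b_gt_mean.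
  rewrite le_eqVlt; apply/orP; left; apply/eqP/esym/cvg_lim => //.
  under eq_fun do rewrite (expectation_log_lr sigma_gt0 tau_gt0 beta_ge0
    beta_le1 X_iid) -EFinM mulrA (mulrC _^-1).
  apply/fine_cvgP; split; first by near=> n.
  apply: cvgMl; exact: cvg_frac_after_change.
have at_gt : 0 < a * (t - 1).
  move: mean_lt; rewrite bE ltr_pM2l// ltrD2l; lra.
(* the tilt at which the limiting generating function has slope b *)
pose s0 := (t - 1) / (2 * a * t).
have t0 : t != 0 by rewrite gt_eqF.
have s0E : 1 - 2 * s0 * a = t^-1.
  by rewrite /s0; field; rewrite a0 t0.
have s0_gt0 : 0 < s0.
  have -> : s0 = a * (t - 1) / (2 * a ^+ 2 * t).
    by rewrite /s0; field; rewrite a0 t0.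
  by rewrite divr_gt0// mulr_gt0// mulr_gt0// exprn_even_gt0.
have s0_dom : 2 * s0 * a < 1 by rewrite -subr_gt0 s0E invr_gt0.
have dom := near_log_mgf_dom s0_dom.
have dE : dlog_mgf beta L a s0 = b by rewrite /dlog_mgf s0E invrK bE.
have limE : log_mgf beta L a s0 - s0 * b = - gamma.
  rewrite /log_mgf s0E lnV ?posrE// gammaE' bE /s0; field.
  by rewrite a0 t0.
have mW n : measurable_fun [set: T] (log_lr X sigma tau beta n).
  exact: measurable_log_lr.
have := @gartner_ellis_half_line _ _ _ P0 (log_lr X sigma tau beta) mW
  (log_mgf beta L a) (dlog_mgf beta L a) s0 s0_gt0.
rewrite dE limE => GE.
apply: cvg_trans (GE _ _ _ _).
- apply: near_eq_cvg; near=> n.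
  have n0 : 0 < n%:R :> R by rewrite ltr0n; near: n; exact: nbhs_infty_gt.
  congr (_ * lne (P0 _))%E; apply/seteqP; split=> w /=;
  by rewrite ler_pdivlMl.
- near=> s.
  have s_dom : 2 * s * a < 1 by near: s.
  under eq_fun do rewrite (mgf_log_lr sigma_gt0 tau_gt0 beta_ge0 beta_le1
    X_iid _ s_dom) lne_expR -EFinM mulrCA (mulrA _ _^-1).
  apply/fine_cvgP; split; first by near=> n.
  apply: cvgMl; exact: cvg_frac_after_change.
- near=> s; apply: is_derive_log_mgf; by near: s.
- exact: continuous_dlog_mgf.
- near=> s; rewrite -dE; apply: dlog_mgf_lt => //.
  by near: s; exact: (cvg_within _ dom).
Unshelve. all: by end_near. Qed.
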